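(* Let $(x_i)_{i=1}^\infty$ be an unconditional semi-normalized basic sequence in a Banach space such that every NCCB basic sequence of $(x_i)$ is good. Then all the spreading models generated by these NCCB basic sequences must be uniformly equivalent to the unit vector basis of $c_0$ or of $\ell_p$ for some $1\leq p<\infty$.
   Context: Scalars are real; bases and basic sequences are Schauder. A sequence $(x_i)$ is semi-normalized if $0<\inf_i\|x_i\|\leq\sup_i\|x_i\|<\infty$. NCCB basic sequence: for finite nonempty $E,F\subset\mathbb{N}$ write $E<F$ if $\max E<\min F$. A sequence $(y_i)_{i=1}^\infty$ is a normalized constant coefficient block basic sequence (NCCB basic sequence) of a basic sequence $(x_i)$ if there are finite nonempty sets $E_1<E_2<\cdots$ of natural numbers such that $y_i=\frac{\sum_{k\in E_i}x_k}{\|\sum_{k\in E_i}x_k\|}$ for all $i$. Good sequence: a normalized basic sequence $(y_i)$ is good if for every $n\in\mathbb{N}$ and all scalars $(a_i)_{i=1}^n$ the limit $\lim_{k_1\to\infty}\|\sum_{i=1}^n a_i y_{k_i}\|$ (over $k_1<k_2<\cdots<k_n$) exists; equivalently, $(y_i)$ generates a spreading model. Spreading model: a basic sequence is $1$-spreading if it is $1$-equivalent to all of its subsequences. A normalized $1$-spreading basis $(e_i)$ of a Banach space $(E,\|\cdot\|_s)$ is the spreading model generated by a normalized basic sequence $(y_i)$ if for all $\epsilon>0$ and $n\in\mathbb{N}$ there is $N\in\mathbb{N}$ such that $\big|\,\|\sum_{i=1}^n a_i y_{k_i}\|-\|\sum_{i=1}^n a_i e_i\|_s\big|\leq\epsilon$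 for all $(a_i)_{i=1}^n\in[-1,1]^n$ and all $N\leq k_1<\cdots<k_n$. Equivalence: for $C\geq1$, sequences $(u_i)$, $(v_i)$ are $C$-equivalent if $\frac1C\|\sum a_i v_i\|\leq\|\sum a_i u_i\|\leq C\|\sum a_i v_i\|$ for all finitely supported scalars $(a_i)$. ''Uniformly equivalent to the unit vector basis of $c_0$ or $\ell_p$'' means that there are one such space and one constant $C\geq 1$ such that all the spreading models in question are $C$-equivalent to the unit vector basis of that space. *)

(* Defs.v *)
From HB Require Import structures.
From mathcomp Require Import all_boot all_order all_algebra finmap.
From mathcomp Require Import all_classical all_reals all_analysis.
Set Implicit Arguments.
Unset Strict Implicit.
Unset Printing Implicit Defensive.
Import Order.TTheory GRing.Theory Num.Theory.
Import numFieldNormedType.Exports.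
Local Open Scope classical_set_scope.
Local Open Scope ring_scope.

Definition closed_span (R : realType) (X : normedModType R) (x : nat -> X)
    : set X :=
  closure [set v | exists (n : nat) (a : 'I_n -> R),
                     v = \sum_(i < n) a i *: x i].

Definition expands (R : realType) (X : normedModType R) (x : nat -> X)
    (v : X) (a : nat -> R) : Prop :=
  series (fun i => a i *: x i) @ \oo --> v.

Definition schauder_basis (R : realType) (E : completeNormedModType R)
    (e : nat -> E) : Prop :=
  forall v : E, exists! a : nat -> R, expands e v a.

Definition basic_sequence (R : realType) (X : completeNormedModType R)
    (x : nat -> X) : Prop :=
  forall v : X, closed_span x v -> exists! a : nat -> R, expands x v a.

Definition unconditional (R : realType) (X : completeNormedModType R)
    (x : nat -> X) : Prop :=
  forall a : nat -> R, cvgn (series (fun i => a i *: x i)) ->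
  forall s : nat -> nat, bijective s ->
    cvgn (series (fun i => a (s i) *: x (s i))).

Definition semi_normalized (R : realType) (X : normedModType R)
    (x : nat -> X) : Prop :=
  (0%:E < ereal_inf (range (fun i => `|x i|%:E)))%E /\
  (ereal_sup (range (fun i => `|x i|%:E)) < +oo)%E.

Definition normalized (R : realType) (X : normedModType R)
    (x : nat -> X) : Prop :=
  forall i, `|x i| = 1.

Definition fset_before (E F : {fset nat}) : Prop :=
  forall i j, i \in E -> j \in F -> (i < j)%N.

Definition nccb (R : realType) (X : normedModType R) (x y : nat -> X) : Prop :=
  exists E : nat -> {fset nat},
    [/\ forall i, E i != fset0,
        forall i, fset_before (E i) (E i.+1) &
        forall i, y i = `|\sum_(k <- E i) x k|^-1 *: \sum_(k <- E i) x k].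

Definition increasing_above (N n : nat) (k : 'I_n -> nat) : Prop :=
  (forall i, (N <= k i)%N) /\ {homo k : i j / (i < j)%N}.

(* Meant for normalized basic sequences; an NCCB sequence of a basic sequence
   is always one. *)
Definition good (R : realType) (X : normedModType R) (y : nat -> X) : Prop :=
  forall (n : nat) (a : 'I_n -> R), exists l : R,
  forall eps : R, 0 < eps -> exists N : nat,
  forall k : 'I_n -> nat, increasing_above N k ->
    `| `|\sum_(i < n) a i *: y (k i)| - l| <= eps.

(* C-equivalence of the sequences u and v, for the norms nU and nV on their
   respective ambient vector spaces. *)
Definition equivalent (R : realType) (U V : lmodType R) (nU : U -> R)
    (nV : V -> R) (C : R) (u : nat -> U) (v : nat -> V) : Prop :=
  forall (n : nat) (a : 'I_n -> R),
    C^-1 * nV (\sum_(i < n) a i *: v i) <= nU (\sum_(i < n) a i *: u i) /\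
    nU (\sum_(i < n) a i *: u i) <= C * nV (\sum_(i < n) a i *: v i).

Definition one_spreading (R : realType) (E : completeNormedModType R)
    (e : nat -> E) : Prop :=
  basic_sequence e /\
  forall k : nat -> nat, {homo k : i j / (i < j)%N} ->
    equivalent (fun v : E => `|v|) (fun v : E => `|v|) 1 e (e \o k).

Definition spreading_model (R : realType) (X E : completeNormedModType R)
    (y : nat -> X) (e : nat -> E) : Prop :=
  [/\ schauder_basis e, normalized e, one_spreading e &
      forall (eps : R) (n : nat), 0 < eps -> exists N : nat,
      forall (a : 'I_n -> R) (k : 'I_n -> nat),
        (forall i, -1 <= a i <= 1) -> increasing_above N k ->
        `| `|\sum_(i < n) a i *: y (k i)| - `|\sum_(i < n) a i *: e i| |
          <= eps].

(* c_0 and l_p are represented by their norms on the space of all scalar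
   sequences; only finite combinations of the unit vectors are ever measured,
   so neither the supremum nor the l_p norm takes an infinite value there. *)
Definition unit_vector (R : realType) (i : nat) : nat -> R^o :=
  fun j => (i == j)%:R.

Definition c0_norm (R : realType) (v : nat -> R^o) : R :=
  sup (range (fun j => `|v j|)).

Definition lp_norm (R : realType) (p : R) (v : nat -> R^o) : R :=
  fine ('N[counting]_(p%:E) [EFin \o v])%E.

(* Main.v *)
Require Import Defs.
From HB Require Import structures.
From mathcomp Require Import all_boot all_order all_algebra finmap.
From mathcomp Require Import all_classical all_reals all_analysis.
From mathcomp Require Import zify ring lra.
Import Order.TTheory GRing.Theory Num.Theory.
Import numFieldNormedType.Exports.
Local Open Scope classical_set_scope.
Local Open Scope ring_scope.

(** All the spreading models have the same norm: if runs of two NCCB sequences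
    alternate, the result is again an NCCB sequence, and its being good forces the
    two limits to agree ([blocks_limit], [spreading_models_agree]).  So let e be
    one of these spreading models (without any, there is nothing to prove).

    A block sum of x over m far out indices at which the norms of x are nearly a
    constant c has norm nearly c * phi m, where phi m is the norm of
    e 0 + ... + e m.-1; since its normalization generates e too, the successive
    normalized sums of vectors of e over intervals of any lengths form a sequence
    isometrically equivalent to e ([model_block]).  In particular phi is
    multiplicative.

    Unconditionality of x is used through a gliding hump: were the norms of subset
    sums not controlled by the norms of initial partial sums in e, small
    combinations far out in x would add up to a convergent series with a divergent
    rearrangement ([unconditional_no_humps], [model_hump]).  To replace initial
    partial sums by the whole sum, there are two cases.  If phi m < m for some m,
    then phi (m ^ t) / m ^ t tends to 0, and averaging over spreads of the tail
    shows that e has basis constant 1 ([head_contraction]).  If phi m = m for all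
    m, then the norm is additive on nonnegative coefficients, and long
    concatenations of copies of one combination give a lower l_1 estimate
    ([l1_lower_bound]).  Either way restriction to a set of indices is uniformly
    bounded and phi is nondecreasing.

    A nondecreasing multiplicative function is a power, phi m = m ^ al with al in
    [0, 1].  If al = 0, convexity gives the c_0 norm up to constants.  If al > 0,
    block homogeneity evaluates exactly the combinations whose coefficients are
    al-th powers of fractions: their norm is the l_p norm for p = 1 / al, and
    approximation together with the uniform bound on restrictions gives the
    equivalence for all coefficients ([block_homogeneous_dichotomy]). *)

(** * Elementary lemmas *)

Lemma sum_shift k m (V : nmodType) (F : nat -> V) :
  \sum_(k <= i < k + m) F i = \sum_(0 <= i < m) F (k + i)%N.
Proof.
by rewrite -{1}[k]add0n big_addn addKn; apply: eq_bigr => i _; rewrite addnC.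
Qed.

Lemma sum_blocks (V : nmodType) (s : nat -> nat) n (F : nat -> V) :
  s 0%N = 0%N -> {homo s : i j / (i < j)%N} ->
  \sum_(0 <= i < s n) F i = \sum_(0 <= j < n) \sum_(s j <= i < s j.+1) F i.
Proof.
move=> s0 hs; elim: n => [|n IH]; first by rewrite s0 !big_geq.
by rewrite big_nat_recr //= -IH -big_cat_nat //=; apply/ltnW/hs.
Qed.

Lemma homo_muln m : (0 < m)%N -> {homo muln^~ m : i j / (i < j)%N}.
Proof. by move=> m0 i j ij; rewrite ltn_mul2r m0. Qed.

Lemma if_scaler (R : pzRingType) (V : lmodType R) (b : bool) (c : R) (v : V) :
  (if b then c *: v else 0) = (if b then c else 0) *: v.
Proof. by case: b; rewrite ?scale0r. Qed.

(** Coefficients constant on each interval from s j to s j.+1. *)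
Lemma sum_interval_coef (R : pzRingType) (V : lmodType R) (s : nat -> nat) n
    (a : nat -> R) (f : nat -> V) :
  {homo s : i j / (i < j)%N} ->
  \sum_(0 <= i < s n) (\sum_(0 <= j < n | (s j <= i < s j.+1)%N) a j) *: f i =
  \sum_(0 <= j < n) a j *: \sum_(s j <= i < s j.+1) f i.
Proof.
move=> hs; under eq_bigr do rewrite scaler_suml big_mkcond /=.
rewrite exchange_big /=; apply: eq_big_nat => j /andP[_ jn].
have sjn : (s j.+1 <= s n)%N.
  by move: jn; rewrite leq_eqVlt => /predU1P[->//|/hs/ltnW].
rewrite scaler_sumr (big_nat_widen _ _ _ _ _ sjn) /=.
rewrite (big_nat_widenl (s j) 0%N) // -big_mkcond /=.
by apply: eq_bigl => i; rewrite andbC.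
Qed.

Lemma finite_limits (P : nat -> nat -> Prop) n :
  (forall j M M', (M <= M')%N -> P j M -> P j M') ->
  (forall j, exists M, P j M) -> exists M, forall j, (j < n)%N -> P j M.
Proof.
move=> mono /choice[f hf]; exists (\max_(j < n) f j) => j jn.
by apply: mono (hf j); exact: (leq_bigmax (Ordinal jn)).
Qed.

Section RealEstimates.
Variable R : realType.

Lemma bernoulli_ineq (h : R) n : 0 <= h -> 1 + n%:R * h <= (1 + h) ^+ n.
Proof.
move=> h0; elim: n => [|n IH]; first by rewrite expr0 mul0r addr0.
rewrite exprS -natr1; have : 0 <= n%:R * h by rewrite mulr_ge0.
have := ler_wpM2l (_ : 0 <= 1 + h) IH; nra.
Qed.

(** Archimedean comparison: an additive error that does not grow with n is
    harmless. *)
Lemma le_of_mulrn_le (x y d : R) :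
  (forall n, (0 < n)%N -> n%:R * x <= n%:R * y + d) -> x <= y.
Proof.
move=> H; rewrite leNgt; apply/negP => xy.
have d0 : 0 <= `|d| / (x - y) by rewrite divr_ge0 // subr_ge0 ltW.
have := archi_boundP d0; set n := Num.Def.archi_bound _ => hn.
have xy' : 0 < x - y by rewrite subr_gt0.
have := H n.+1 isT; rewrite -natr1.
rewrite ltr_pdivrMr // in hn; have := ler_norm d; nra.
Qed.

(** The multiplicative version: a constant factor K is lost when n-th roots
    are taken. *)
Lemma le_of_exprn_le (x y K : R) : 0 <= x -> 0 <= y ->
  (forall n, x ^+ n <= K * y ^+ n) -> x <= y.
Proof.
move=> x0; rewrite le0r => /predU1P[-> H|y0 H].
  by have := H 1%N; rewrite !expr1 mulr0.
rewrite leNgt; apply/negP => yx.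
have h0 : 0 < x / y - 1 by rewrite subr_gt0 ltr_pdivlMr ?mul1r.
suff : x / y - 1 <= 0 by rewrite leNgt h0.
apply: (@le_of_mulrn_le _ _ K) => n _; rewrite mulr0 add0r.
have := @bernoulli_ineq _ n (ltW h0); rewrite subrKC expr_div_n.
have := H n; rewrite -ler_pdivrMr ?exprn_gt0 //; lra.
Qed.

Lemma eq0_of_le_small (z K : R) :
  (forall d, 0 < d -> `|z| <= K * d) -> z = 0.
Proof.
move=> H; apply/eqP; rewrite -normr_le0 leNgt; apply/negP => z0.
have d0 : 0 < `|z| / (2 * (`|K| + 1)) by rewrite divr_gt0 ?mulr_gt0 ?ltr_wpDl.
have := H _ d0; rewrite mulrA ler_pdivlMr ?mulr_gt0 ?ltr_wpDl //.
have := ler_norm K; have := normr_ge0 K; nra.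
Qed.

End RealEstimates.

(** * Sequences isometric to their constant coefficient blocks *)

Section BlockHomogeneousSequences.
Variables (R : realType) (E : normedModType R) (e : nat -> E).

(** The fundamental function of e. *)
Let phi m := `|\sum_(0 <= i < m) e i|.

(** Constant coefficient combinations of e behave like single vectors: e is
    normalized, isometric to its subsequences and to its normalized blocks
    with constant coefficients, and the norm of a partial sum over an arbitrary
    set of indices is controlled by the norms of the initial partial sums. *)
Hypothesis e_norm : forall i, `|e i| = 1.
Hypothesis e_spread : forall k : nat -> nat, {homo k : i j / (i < j)%N} ->
  forall n (a : nat -> R),
  `|\sum_(0 <= i < n) a i *: e (k i)| = `|\sum_(0 <= i < n) a i *: e i|.
Hypothesis e_block : forall s : nat -> nat, {homo s : i j / (i < j)%N} ->
  forall n (a : nat -> R),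
  `|\sum_(0 <= j < n) a j *: \sum_(s j <= i < s j.+1) e i| =
  `|\sum_(0 <= j < n) (a j * phi (s j.+1 - s j)) *: e j|.
Hypothesis e_hump : exists2 C : R, 0 <= C &
  forall n (a : nat -> R) (A : pred nat) B,
  (forall k, (k <= n)%N -> `|\sum_(0 <= i < k) a i *: e i| <= B) ->
  `|\sum_(0 <= i < n | A i) a i *: e i| <= C * B.

Lemma norm_sum_le_l1 m n (a : nat -> R) :
  `|\sum_(m <= i < n) a i *: e i| <= \sum_(m <= i < n) `|a i|.
Proof.
apply: le_trans (ler_norm_sum _ _ _) _; apply: ler_sum => i _.
by rewrite normrZ e_norm mulr1.
Qed.

Lemma norm_sum_shift k n (a : nat -> R) :
  `|\sum_(0 <= i < n) a i *: e (k + i)| = `|\sum_(0 <= i < n) a i *: e i|.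
Proof. by apply: (e_spread (addn k)) => i j; rewrite ltn_add2l. Qed.

Lemma phi0 : phi 0 = 0. Proof. by rewrite /phi big_geq ?normr0. Qed.

Lemma phi1 : phi 1 = 1. Proof. by rewrite /phi big_nat1. Qed.

Lemma phi_le m : phi m <= m%:R.
Proof.
rewrite /phi; under eq_bigr do rewrite -[e _]scale1r.
apply: le_trans (norm_sum_le_l1 0 m (fun=> 1)) _.
by rewrite normr1 sumr_const_nat subn0.
Qed.

Lemma phi_blocks (s : nat -> nat) n :
  s 0%N = 0%N -> {homo s : i j / (i < j)%N} ->
  phi (s n) = `|\sum_(0 <= j < n) phi (s j.+1 - s j) *: e j|.
Proof.
move=> s0 hs; have := e_block _ hs n (fun=> 1).
under eq_bigr do rewrite scale1r.
by under [in RHS]eq_bigr do rewrite mul1r; rewrite -sum_blocks.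
Qed.

(** The sum of m * n vectors is a sum of n blocks of length m. *)
Lemma phiM m n : phi (m * n) = phi m * phi n.
Proof.
case: m => [|m]; first by rewrite mul0n phi0 mul0r.
rewrite mulnC (@phi_blocks (muln^~ m.+1) n) //; last exact: homo_muln.
under eq_bigr do rewrite mulSn addnK.
by rewrite -scaler_sumr normrZ normr_id.
Qed.

Lemma phiX m t : phi (m ^ t) = phi m ^+ t.
Proof.
by elim: t => [|t IH]; rewrite ?expn0 ?phi1 // expnS phiM IH exprS.
Qed.

Lemma sum_norm_coef n (a : nat -> R) :
  \sum_(0 <= i < n) `|a i| *: e i =
  \sum_(0 <= i < n | 0 <= a i) a i *: e i -
  \sum_(0 <= i < n | ~~ (0 <= a i)) a i *: e i.
Proof.
rewrite (bigID (fun i => 0 <= a i)) /= -sumrN; congr (_ + _).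
  by apply: eq_bigr => i h; rewrite ger0_norm.
apply: eq_bigr => i; rewrite -ltNge => h.
by rewrite ltr0_norm // scaleNr.
Qed.

(** If phi is the identity, then e is equivalent to the basis of l_1. *)
Section AdditiveCase.
Hypothesis phi_id : forall m, phi m = m%:R.

Lemma norm_nonneg_sum n (a : nat -> R) : (forall i, 0 <= a i) ->
  `|\sum_(0 <= i < n) a i *: e i| = \sum_(0 <= i < n) a i.
Proof.
move=> a0; set M := \sum_(0 <= i < n) a i.
have aM i : (i < n)%N -> a i <= M.
  move=> ln; rewrite /M (big_rem i) /=; last by rewrite mem_index_iota.
  by rewrite lerDl sumr_ge0.
have M0 : 0 <= M by apply: sumr_ge0.
apply/le_anti/andP; split.
  apply: le_trans (norm_sum_le_l1 _ _ _) _; apply: ler_sum => i _.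
  by rewrite ger0_norm.
(* the left-hand side is M * phi n = M * n *)
have : `|\sum_(0 <= i < n) M *: e i| <=
    `|\sum_(0 <= i < n) a i *: e i| + `|\sum_(0 <= i < n) (M - a i) *: e i|.
  apply: le_trans (ler_normD _ _); rewrite -big_split /= le_eqVlt; apply/orP; left.
  by apply/eqP; congr (`|_|); apply: eq_bigr => i _; rewrite -scalerDl addrC subrK.
rewrite -scaler_sumr normrZ -/(phi n) phi_id ger0_norm //.
have : `|\sum_(0 <= i < n) (M - a i) *: e i| <= \sum_(0 <= i < n) (M - a i).
  apply: le_trans (norm_sum_le_l1 _ _ _) _; rewrite !big_nat.
  by apply: ler_sum => i ln; rewrite ger0_norm // subr_ge0 aM.
rewrite sumrB sumr_const_nat subn0 -mulr_natr -/M; lra.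
Qed.

(** Concatenating m copies of a multiplies the norm by at most m, while an
    initial partial sum exceeds a whole number of copies by at most the l_1 norm
    T of a.  So the control of partial sums, applied to the positive and the
    negative coefficients, gives m * T <= 2 * C * (m * N + T) for every m. *)
Lemma l1_lower_bound : exists2 C : R, 0 <= C & forall n (a : nat -> R),
  \sum_(0 <= i < n) `|a i| <= C * `|\sum_(0 <= i < n) a i *: e i|.
Proof.
have [C C0 hC] := e_hump; exists (2 * C); first by rewrite mulr_ge0.
move=> n a; case: (posnP n) => [->|n0]; first by rewrite !big_geq // normr0 mulr0.
set T := \sum_(0 <= i < n) `|a i|; set N := `|_|.
apply: (@le_of_mulrn_le _ _ _ (2 * C * T)) => m m0.
(* coefficients of m successive copies of a *)
pose b i := a (i %% n)%N.
have bE q (f : nat -> E) r : (r <= n)%N -> \sum_(q * n <= i < q * n + r) b i *: f i =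
    \sum_(0 <= i < r) a i *: f (q * n + i)%N.
  move=> rn; rewrite sum_shift !big_nat.
  apply: eq_bigr => i ir; congr (_ *: _); rewrite /b.
  by rewrite modnMDl modn_small // (leq_trans _ rn).
have bq q : `|\sum_(0 <= i < q * n) b i *: e i| <= q%:R * N.
  elim: q => [|q IH]; first by rewrite mul0n big_geq // normr0 mul0r.
  rewrite (@big_cat_nat _ _ _ (q * n)%N) //=; last by rewrite leq_mul2r leqnSn orbT.
  rewrite -natr1 mulrDl mul1r; apply: le_trans (ler_normD _ _) _; apply: lerD => //.
  by rewrite mulSn addnC bE // norm_sum_shift.
have bB k : (k <= m * n)%N -> `|\sum_(0 <= i < k) b i *: e i| <= m%:R * N + T.
  move=> km; rewrite (divn_eq k n).
  rewrite (@big_cat_nat _ _ _ (k %/ n * n)%N) //=; last by rewrite leq_addr.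
  have rn : (k %% n <= n)%N by rewrite ltnW // ltn_mod.
  apply: le_trans (ler_normD _ _) _; apply: lerD.
    apply: le_trans (bq _) _; rewrite ler_wpM2r ?normr_ge0 // ler_nat.
    by rewrite -(leq_pmul2r n0) (leq_trans (leq_trunc_div _ _)).
  rewrite bE // norm_sum_shift; apply: le_trans (norm_sum_le_l1 _ _ _) _.
  rewrite /T [leRHS](@big_cat_nat _ _ _ (k %% n)%N) //=.
  by rewrite lerDl sumr_ge0.
have -> : m%:R * T = `|\sum_(0 <= i < m * n) `|b i| *: e i|.
  rewrite norm_nonneg_sum //; elim: m {m0 bB} => [|m IH].
    by rewrite mul0n big_geq // mul0r.
  rewrite (@big_cat_nat _ _ _ (m * n)%N) //=; last by rewrite leq_mul2r leqnSn orbT.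
  rewrite -natr1 mulrDl mul1r IH; congr (_ + _).
  rewrite mulSn addnC sum_shift /T !big_nat.
  by apply: eq_bigr => i ir; rewrite /b modnMDl modn_small.
have -> : m%:R * (2 * C * N) + 2 * C * T =
    C * (m%:R * N + T) + C * (m%:R * N + T) by ring.
rewrite sum_norm_coef; apply: le_trans (ler_normB _ _) _.
by apply: lerD; apply: hC.
Qed.

End AdditiveCase.

(** If phi m0 < m0 for some m0, then phi m / m takes arbitrarily small values, and
    e has basis constant 1. *)
Section SubadditiveCase.
Variable m0 : nat.
Hypothesis phi_m0 : phi m0 < m0%:R.

(** Keep the first k vectors fixed and average the rest over m disjoint spreads,
    the j-th of which moves e i to e (i * m + j).  Each spread has the same norm
    as the original sum; the averaged tails form blocks of length m, whose norm
    is q * phi m / m, and this is arbitrarily small. *)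
Lemma head_contraction k n (a : nat -> R) : (k <= n)%N ->
  `|\sum_(0 <= i < k) a i *: e i| <= `|\sum_(0 <= i < n) a i *: e i|.
Proof.
move=> kn; set N := `|\sum_(0 <= i < n) _|.
pose b i := if (k <= i)%N then a i else 0.
set q := `|\sum_(0 <= i < n) b i *: e i|.
have m00 : (0 < m0)%N by case: m0 phi_m0 => //; rewrite phi0 ltxx.
have avg m : (0 < m)%N ->
    m%:R * `|\sum_(0 <= i < k) a i *: e i| <= m%:R * N + phi m * q.
  move=> mp; pose sg j i := if (i < k)%N then i else (i * m + j)%N.
  have sgN j : (j < m)%N -> `|\sum_(0 <= i < n) a i *: e (sg j i)| = N.
    move=> jm; apply: (e_spread (sg j)) => i i' ii; rewrite /sg.
    by case: (ltnP i k) => h; case: (ltnP i' k) => h' //; nia.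
  have qE : `|\sum_(0 <= i < n) b i *: \sum_(i * m <= l < i.+1 * m) e l| = phi m * q.
    rewrite (e_block (muln^~ m) (homo_muln _ mp)).
    under eq_bigr do rewrite mulSn addnK mulrC -scalerA.
    by rewrite -scaler_sumr normrZ normr_id.
  have sumE : \sum_(0 <= j < m) \sum_(0 <= i < n) a i *: e (sg j i) =
      m%:R *: (\sum_(0 <= i < k) a i *: e i) +
      \sum_(0 <= i < n) b i *: \sum_(i * m <= l < i.+1 * m) e l.
    rewrite exchange_big /= (@big_cat_nat _ _ _ k) //=.
    rewrite [X in _ = _ + X](@big_cat_nat _ _ _ k) //=.
    rewrite [X in _ = _ + (X + _)]big1_seq ?add0r; last first.
      by move=> i; rewrite mem_index_iota /b leq0n /= => ik; rewrite leqNgt ik scale0r.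
    rewrite scaler_sumr; congr (_ + _); apply: eq_big_nat => i /andP[i1 i2].
      by rewrite /sg i2 sumr_const_nat subn0 scaler_nat.
    rewrite /b i1 mulSn [(m + i * m)%N]addnC (sum_shift (i * m)) scaler_sumr.
    by apply: eq_bigr => j _; rewrite /sg ltnNge i1.
  rewrite -(ger0_norm (ler0n R m)) -normrZ.
  rewrite -[_ *: _](addrK (\sum_(0 <= i < n) b i *: \sum_(i * m <= l < i.+1 * m) e l)).
  rewrite -sumE -qE; apply: le_trans (ler_normB _ _) _; apply: lerD => //.
  apply: le_trans (ler_norm_sum _ _ _) _; rewrite big_nat.
  under eq_bigr => j jm do rewrite sgN //.
  by rewrite -big_nat sumr_const_nat subn0 ger0_norm // mulr_natl.
apply/ler_addgt0Pr => eps eps0.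
(* phi (m0 ^ t) / m0 ^ t tends to 0 *)
have [t ht] : exists t, (phi m0 / m0%:R) ^+ t * q <= eps.
  apply: contrapT => H; suff : 1 <= phi m0 / m0%:R.
    by rewrite leNgt ltr_pdivrMr ?ltr0n // mul1r phi_m0.
  apply: (@le_of_exprn_le _ _ _ (q / eps)) => // [|t].
    by rewrite divr_ge0 // normr_ge0.
  rewrite expr1n mulrAC ler_pdivlMr // mul1r mulrC leNgt; apply/negP => h.
  by apply: H; exists t; exact: ltW.
have := avg (m0 ^ t)%N; rewrite expn_gt0 m00 phiX natrX => /(_ isT).
move: ht; rewrite expr_div_n.
have M0 : 0 < m0%:R ^+ t :> R by rewrite exprn_gt0 // ltr0n.
rewrite mulrAC ler_pdivrMr // => ht h.
rewrite -(ler_pM2l M0) mulrDr; lra.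
Qed.

End SubadditiveCase.

Lemma phi_dichotomy : (forall m, phi m = m%:R) \/ exists m0, phi m0 < m0%:R.
Proof.
case: (pselect (exists m0, phi m0 < m0%:R)) => [|H]; first by right.
left=> m; apply/le_anti; rewrite phi_le /= leNgt; apply/negP => h.
by apply: H; exists m.
Qed.

(** Restricting a combination of e to any set of indices multiplies its norm by
    at most a constant. *)
Lemma suppression_bound : exists2 C : R, 1 <= C &
  forall n (a : nat -> R) (A : pred nat),
  `|\sum_(0 <= i < n | A i) a i *: e i| <= C * `|\sum_(0 <= i < n) a i *: e i|.
Proof.
have wlog1 C : (forall n (a : nat -> R) (A : pred nat),
    `|\sum_(0 <= i < n | A i) a i *: e i| <= C * `|\sum_(0 <= i < n) a i *: e i|) ->
    exists2 C : R, 1 <= C & forall n (a : nat -> R) (A : pred nat),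
  `|\sum_(0 <= i < n | A i) a i *: e i| <= C * `|\sum_(0 <= i < n) a i *: e i|.
  move=> h; exists (Num.max C 1); first by rewrite le_max lexx orbT.
  move=> n a A; apply: le_trans (h n a A) _; rewrite ler_wpM2r //.
  by rewrite le_max lexx.
case: phi_dichotomy => [phi_id|[m0 hm0]].
  have [C C0 hC] := l1_lower_bound phi_id; apply: (wlog1 C) => n a A.
  apply: le_trans (hC n a); rewrite big_mkcond /=.
  under eq_bigr do rewrite if_scaler.
  apply: le_trans (norm_sum_le_l1 _ _ _) _; apply: ler_sum => i _.
  by case: (A i); rewrite ?normr0.
have [C C0 hC] := e_hump; apply: (wlog1 C) => n a A; apply: hC => k kn.
exact: head_contraction _ hm0 _ _ _ kn.
Qed.

Lemma phi_mono : {homo phi : m n / (m <= n)%N >-> m <= n}.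
Proof.
move=> m n mn; case: phi_dichotomy => [phi_id|[m0 hm0]].
  by rewrite !phi_id ler_nat.
have := @head_contraction m0 hm0 m n (fun=> 1) mn.
by under eq_bigr do rewrite scale1r; under [in leRHS]eq_bigr do rewrite scale1r.
Qed.

(** A nondecreasing completely multiplicative function is a power: sandwich
    m ^ t between consecutive powers of 2 and take t-th roots. *)
Lemma phi_powR : exists2 al : R, 0 <= al <= 1 &
  forall m, (0 < m)%N -> phi m = m%:R `^ al.
Proof.
have phi2_ge1 : 1 <= phi 2 by rewrite -phi1 phi_mono.
have phi_gt0 m : (0 < m)%N -> 0 < phi m.
  by move=> m0; apply: lt_le_trans (phi_mono _ _ m0); rewrite phi1.
have ln2 : 0 < ln 2%:R :> R by rewrite ln_gt0 // ltr1n.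
pose al := ln (phi 2) / ln 2%:R.
have al01 : 0 <= al <= 1.
  apply/andP; split; first by rewrite divr_ge0 ?(ltW ln2) // ln_ge0.
  rewrite ler_pdivrMr // mul1r.
  by rewrite ler_ln ?posrE ?phi_gt0 ?ltr0n // phi_le.
have /andP[al0 _] := al01.
have p2 : 2%:R `^ al = phi 2.
  by rewrite /powR pnatr_eq0 /= /al divfK ?gt_eqF // lnK // posrE phi_gt0.
have powX m t : (m%:R `^ al) ^+ t = (m ^ t)%:R `^ al.
  by rewrite -powR_mulrn ?powR_ge0 // powRAC powR_mulrn ?ler0n // natrX.
exists al => // m m0.
have mt0 t : (0 < m ^ t)%N by rewrite expn_gt0 m0.
have pos : 0 < m%:R `^ al by rewrite powR_gt0 // ltr0n.
have bnd t : exists2 r, phi 2 ^+ r <= phi m ^+ t <= phi 2 ^+ r.+1 &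
    phi 2 ^+ r <= (m%:R `^ al) ^+ t <= phi 2 ^+ r.+1.
  have h1 : (2 ^ trunc_log 2 (m ^ t) <= m ^ t)%N by exact: trunc_logP.
  have h2 : (m ^ t <= 2 ^ (trunc_log 2 (m ^ t)).+1)%N by apply/ltnW/trunc_log_ltn.
  exists (trunc_log 2 (m ^ t)); apply/andP.
    by rewrite -!phiX; split; apply: phi_mono.
  by rewrite powX -p2 !powX; split; apply: ge0_ler_powR => //;
    rewrite ?nnegrE ?ler0n // ler_nat.
apply/le_anti/andP; split; apply: (@le_of_exprn_le _ _ _ (phi 2)) => //;
  rewrite ?phi_gt0 ?normr_ge0 ?(ltW pos) // => t; have [r] := bnd t; rewrite !exprS;
  move=> /andP[h1 h2] /andP[h3 h4].
- by apply: le_trans h2 _; rewrite ler_wpM2l // (le_trans ler01).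
- by apply: le_trans h4 _; rewrite ler_wpM2l // (le_trans ler01).
Qed.

(** The norm is convex, so on the cube [0, 1]^n it is largest at a vertex. *)
Lemma cube_bound n (f : nat -> E) (B : R) (w : E) :
  (forall b : nat -> bool, `|w + \sum_(0 <= i < n) (b i)%:R *: f i| <= B) ->
  forall t : nat -> R, (forall i, 0 <= t i <= 1) ->
  `|w + \sum_(0 <= i < n) t i *: f i| <= B.
Proof.
elim: n w => [|n IH] w H t t01.
  by have := H (fun=> false); rewrite !big_geq.
rewrite big_nat_recr //= [X in w + X]addrC addrA; apply: IH => // b.
set v := \sum_(0 <= i < n) _.
have h0 : `|w + v| <= B.
  have := H (fun i => (i != n) && b i); rewrite big_nat_recr //= eqxx scale0r addr0.
  rewrite big_nat; under eq_bigr => i /ltn_eqF ni do rewrite ni /=.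
  by rewrite -big_nat.
have h1 : `|w + v + f n| <= B.
  have := H (fun i => (i == n) || b i); rewrite big_nat_recr //= eqxx scale1r.
  rewrite big_nat; under eq_bigr => i /ltn_eqF ni do rewrite ni /=.
  by rewrite -big_nat addrA.
have /andP[t0 t1] := t01 n.
have -> : w + t n *: f n + v = (1 - t n) *: (w + v) + t n *: (w + v + f n).
  by rewrite [t n *: (_ + f n)]scalerDr addrA -scalerDl subrK scale1r addrAC.
apply: le_trans (ler_normD _ _) _; rewrite !normrZ !ger0_norm ?subr_ge0 //.
have : 0 <= 1 - t n by rewrite subr_ge0.
move: h0 h1; nra.
Qed.

Section SuppressionConsequences.
Variable C : R.
Hypothesis C1 : 1 <= C.
Hypothesis hC : forall n (a : nat -> R) (A : pred nat),
  `|\sum_(0 <= i < n | A i) a i *: e i| <= C * `|\sum_(0 <= i < n) a i *: e i|.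

Let C0 : 0 <= C. Proof. exact: le_trans ler01 C1. Qed.

Lemma norm_monotone n (a b : nat -> R) :
  (forall i, (i < n)%N -> 0 <= a i <= b i) ->
  `|\sum_(0 <= i < n) a i *: e i| <= C * `|\sum_(0 <= i < n) b i *: e i|.
Proof.
move=> ab; pose t i := if (i < n)%N then a i / b i else 0.
have t01 i : 0 <= t i <= 1.
  rewrite /t; case: ifP => ln; last by rewrite lexx ler01.
  have /andP[a0 aleb] := ab i ln; have b0 := le_trans a0 aleb.
  rewrite divr_ge0 //=; move: b0; rewrite le0r => /predU1P[->|b0].
    by rewrite invr0 mulr0 ler01.
  by rewrite ler_pdivrMr // mul1r.
have -> : \sum_(0 <= i < n) a i *: e i = \sum_(0 <= i < n) t i *: (b i *: e i).
  apply: eq_big_nat => i /= ln; have /andP[a0 aleb] := ab i ln.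
  rewrite scalerA /t ln; case: (eqVneq (b i) 0) => [b0|b0]; last by rewrite divfK.
  by have -> : a i = 0 by [apply/le_anti; rewrite a0 -b0 aleb]; rewrite !mul0r.
rewrite -[\sum_(0 <= i < n) t i *: _]add0r; apply: cube_bound => // c.
rewrite add0r; apply: le_trans (hC n b c); rewrite [in leRHS]big_mkcond /=.
rewrite le_eqVlt; apply/orP; left; apply/eqP; congr `|_|; apply: eq_bigr => i _.
by case: (c i); rewrite ?scale1r ?scale0r.
Qed.

Lemma norm_abs_le n (a : nat -> R) :
  `|\sum_(0 <= i < n) `|a i| *: e i| <= 2 * C * `|\sum_(0 <= i < n) a i *: e i|.
Proof.
rewrite sum_norm_coef; apply: le_trans (ler_normB _ _) _.
by rewrite mulr2n mulrDl mul1r mulrDl; apply: lerD; apply: hC.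
Qed.

Lemma norm_le_abs n (a : nat -> R) :
  `|\sum_(0 <= i < n) a i *: e i| <= 2 * C * `|\sum_(0 <= i < n) `|a i| *: e i|.
Proof.
have -> : \sum_(0 <= i < n) a i *: e i =
    \sum_(0 <= i < n | 0 <= a i) `|a i| *: e i -
    \sum_(0 <= i < n | ~~ (0 <= a i)) `|a i| *: e i.
  rewrite (bigID (fun i => 0 <= a i)) /= -sumrN; congr (_ + _).
    by apply: eq_bigr => i h; rewrite ger0_norm.
  apply: eq_bigr => i; rewrite -ltNge => h.
  by rewrite ltr0_norm // scaleNr opprK.
apply: le_trans (ler_normB _ _) _.
by rewrite mulr2n mulrDl mul1r mulrDl; apply: lerD; apply: hC.
Qed.

Lemma coef_le n (a : nat -> R) i : (i < n)%N ->
  `|a i| <= C * `|\sum_(0 <= i < n) a i *: e i|.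
Proof.
move=> ln; apply: le_trans (hC n a (pred1 i)).
rewrite (eq_bigl (eq_op^~ i)) // big_nat1_eq ln /= normrZ e_norm mulr1 //.
Qed.

Lemma norm_le_sup n (a : nat -> R) B : (forall m, phi m <= 1) -> 0 <= B ->
  (forall i, (i < n)%N -> `|a i| <= B) ->
  `|\sum_(0 <= i < n) a i *: e i| <= 2 * C * C * B.
Proof.
move=> hphi B0 aB; apply: le_trans (norm_le_abs _ _) _.
rewrite -[leRHS]mulrA; apply: ler_wpM2l; first by rewrite mulr_ge0.
apply: le_trans (@norm_monotone n (fun i => `|a i|) (fun=> B) _) _.
  by move=> i ln; rewrite normr_ge0 aB.
apply: ler_wpM2l => //; rewrite -scaler_sumr normrZ ger0_norm //.
by rewrite ler_piMr // hphi.
Qed.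

Section PowerCase.
Variable al : R.
Hypotheses (al0 : 0 < al) (al1 : al <= 1).
Hypothesis hphi : forall m, (0 < m)%N -> phi m = m%:R `^ al.

(** Blocks of lengths m 0, ..., m n.-1 add up to one block, so combinations whose
    coefficients are al-th powers of fractions have exactly the l_p norm,
    p = 1 / al. *)
Lemma norm_powR_frac M (m : nat -> nat) n :
  (0 < M)%N -> (0 < n)%N -> (forall i, (0 < m i)%N) ->
  `|\sum_(0 <= i < n) ((m i)%:R / M%:R) `^ al *: e i| =
  (\sum_(0 <= i < n) (m i)%:R / M%:R) `^ al.
Proof.
move=> M0 n0 m0; pose s j := (\sum_(0 <= i < j) m i)%N.
have sS j : s j.+1 = (s j + m j)%N by rewrite /s big_nat_recr.
have hs : {homo s : i j / (i < j)%N}.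
  by apply: homo_ltn => [|i]; [exact: ltn_trans|rewrite sS -addn1 leq_add2l].
have s0 : s 0%N = 0%N by rewrite /s big_geq.
have sn0 : (0 < s n)%N by rewrite -s0 hs.
have := phi_blocks _ n s0 hs; under eq_bigr do rewrite sS addKn hphi //.
rewrite hphi // => h; under eq_bigr do rewrite powRM ?invr_ge0 ?ler0n // mulrC -scalerA.
rewrite -scaler_sumr normrZ -h -mulr_suml powRM ?invr_ge0 ?ler0n ?sumr_ge0 //.
by rewrite ger0_norm ?powR_ge0 // mulrC /s natr_sum.
Qed.

Lemma le_of_powR_inv (x y K : R) :
  (forall M, (0 < M)%N -> x <= y + K * (M%:R^-1) `^ al) -> x <= y.
Proof.
move=> H; rewrite leNgt; apply/negP => yx; have d0 : 0 < x - y by rewrite subr_gt0.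
have := archi_boundP (powR_ge0 (`|K| / (x - y)) al^-1).
set M := Num.Def.archi_bound _ => hM.
have M0 : (0 < M)%N by rewrite -(ltr_nat R) (le_lt_trans _ hM) ?powR_ge0.
have MR : 0 < M%:R :> R by rewrite ltr0n.
have inv1 : M%:R^-1 `^ al * M%:R `^ al = 1.
  by rewrite -powRM ?invr_ge0 ?ler0n // mulVf ?gt_eqF // powR1.
have : `|K| / (x - y) < M%:R `^ al.
  have -> : `|K| / (x - y) = ((`|K| / (x - y)) `^ al^-1) `^ al.
    by rewrite -powRrM mulVf ?gt_eqF // powRr1 // divr_ge0 // ltW.
  by apply: gt0_ltr_powR => //; rewrite ?nnegrE ?powR_ge0 ?ler0n.
rewrite ltr_pdivrMr // => h; have := H M M0; have := ler_norm K.
have := powR_gt0 al (_ : 0 < M%:R^-1 :> R); rewrite invr_gt0 => /(_ MR).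
move: h inv1; set u := _ `^ al; set v := _ `^ al; nra.
Qed.

Lemma powRD_le (s t : R) : 0 <= s -> 0 <= t ->
  (s + t) `^ al <= 2 * (s `^ al + t `^ al).
Proof.
wlog ts : s t / t <= s => [H|] s0 t0.
  case: (leP t s) => h; first exact: H.
  by rewrite addrC [s `^ _ + _]addrC H // ltW.
apply: (@le_trans _ _ ((2 * s) `^ al)).
  by apply: ge0_ler_powR; rewrite ?(ltW al0) ?nnegrE ?addr_ge0 ?mulr_ge0 //; lra.
rewrite powRM //; apply: (@le_trans _ _ (2 * s `^ al)).
  by apply: ler_wpM2r; [exact: powR_ge0|apply: ler1_powR; rewrite ?ler1n].
by rewrite ler_pM2l // lerDl powR_ge0.
Qed.

(** Approximate a i ^ (1 / al) from above by positive fractions with denominator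
    M; positivity makes all the blocks nonempty. *)
Lemma lp_bounds_nonneg n (a : nat -> R) : (forall i, 0 <= a i) ->
  let T := (\sum_(0 <= i < n) a i `^ al^-1) `^ al in
  T <= 2 * C * `|\sum_(0 <= i < n) a i *: e i| /\
  `|\sum_(0 <= i < n) a i *: e i| <= 2 * C * T.
Proof.
move=> a0 /=; case: (posnP n) => [->|n0].
  by rewrite !big_geq // normr0 powR0 ?gt_eqF // mulr0.
set S := \sum_(0 <= i < n) a i `^ al^-1.
have S0 : 0 <= S by apply: sumr_ge0 => i _; exact: powR_ge0.
have powK i : (a i `^ al^-1) `^ al = a i by rewrite -powRrM mulVf ?gt_eqF // powRr1.
pose m M i := (Num.Def.trunc (M%:R * a i `^ al^-1)).+1.
have mb M i : (0 < M)%N ->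
    a i `^ al^-1 <= (m M i)%:R / M%:R <= a i `^ al^-1 + M%:R^-1.
  move=> M0; have M0' : 0 < M%:R :> R by rewrite ltr0n.
  have h : 0 <= M%:R * a i `^ al^-1 by rewrite mulr_ge0 ?ler0n ?powR_ge0.
  have /andP[h1 h2] := truncn_itv h.
  rewrite ler_pdivlMr // ler_pdivrMr // mulrDl mulVf ?gt_eqF // mulrC (ltW h2) /=.
  by rewrite /m -natr1 lerD2r.
have mono (u v : R) : 0 <= u -> u <= v -> u `^ al <= v `^ al.
  by move=> u0 uv; apply: ge0_ler_powR; rewrite ?(ltW al0) ?nnegrE // (le_trans u0).
split.
  apply: (@le_of_powR_inv _ _ (2 * C * `|\sum_(0 <= i < n) e i|)) => M M0.
  apply: (@le_trans _ _ ((\sum_(0 <= i < n) (m M i)%:R / M%:R) `^ al)).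
    by apply: mono => //; apply: ler_sum => i _; have /andP[] := mb M i M0.
  rewrite -norm_powR_frac //.
  apply: le_trans (@norm_monotone n _ (fun i => 2 * (a i + M%:R^-1 `^ al)) _) _.
    move=> i _; rewrite powR_ge0 /=; have /andP[h1 h2] := mb M i M0.
    apply: le_trans (mono _ _ (le_trans (powR_ge0 _ _) h1) h2) _.
    apply: le_trans (powRD_le _ _ (powR_ge0 _ _) _) _; first by rewrite invr_ge0.
    by rewrite powK.
  have -> : \sum_(0 <= i < n) (2 * (a i + M%:R^-1 `^ al)) *: e i =
      2 *: \sum_(0 <= i < n) (a i + M%:R^-1 `^ al) *: e i.
    by rewrite scaler_sumr; apply: eq_bigr => i _; rewrite scalerA.
  rewrite normrZ ger0_norm //.
  have : `|\sum_(0 <= i < n) (a i + M%:R^-1 `^ al) *: e i| <=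
     `|\sum_(0 <= i < n) a i *: e i| + M%:R^-1 `^ al * `|\sum_(0 <= i < n) e i|.
    under eq_bigr do rewrite scalerDl; rewrite big_split /= -scaler_sumr.
    by apply: le_trans (ler_normD _ _) _; rewrite normrZ (ger0_norm (powR_ge0 _ _)).
  have : 0 <= 2 * C by rewrite mulr_ge0.
  nra.
apply: (@le_of_powR_inv _ _ (2 * C * n%:R `^ al)) => M M0.
apply: (@le_trans _ _ (C * `|\sum_(0 <= i < n) ((m M i)%:R / M%:R) `^ al *: e i|)).
  apply: norm_monotone => i _; rewrite a0 -{1}powK.
  by apply: mono; rewrite ?powR_ge0 //; have /andP[] := mb M i M0.
rewrite norm_powR_frac //.
have : (\sum_(0 <= i < n) (m M i)%:R / M%:R) `^ al <= (S + n%:R * M%:R^-1) `^ al.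
  apply: mono; first by apply: sumr_ge0 => i _; rewrite divr_ge0.
  have -> : n%:R * M%:R^-1 = \sum_(0 <= i < n) (M%:R^-1 : R).
    by rewrite sumr_const_nat subn0 mulr_natl.
  by rewrite -big_split; apply: ler_sum => i _; have /andP[] := mb M i M0.
have := powRD_le S (n%:R * M%:R^-1) S0; rewrite mulr_ge0 ?invr_ge0 // => /(_ isT).
rewrite [(n%:R * _) `^ al]powRM ?invr_ge0 // => h2 h1.
apply: le_trans (ler_wpM2l C0 (le_trans h1 h2)) _.
by rewrite le_eqVlt; apply/orP; left; apply/eqP; ring.
Qed.

End PowerCase.
End SuppressionConsequences.

(** A block homogeneous sequence is equivalent to the unit vector basis of c_0
    (when phi is bounded) or of some l_p. *)
Theorem block_homogeneous_dichotomy : exists2 C : R, 1 <= C &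
  (forall n (a : nat -> R),
    (forall i, (i < n)%N -> `|a i| <= C * `|\sum_(0 <= i < n) a i *: e i|) /\
    (forall B, 0 <= B -> (forall i, (i < n)%N -> `|a i| <= B) ->
      `|\sum_(0 <= i < n) a i *: e i| <= C * B)) \/
  (exists2 p : R, 1 <= p & forall n (a : nat -> R),
    let T := (\sum_(0 <= i < n) `|a i| `^ p) `^ p^-1 in
    T <= C * `|\sum_(0 <= i < n) a i *: e i| /\
    `|\sum_(0 <= i < n) a i *: e i| <= C * T).
Proof.
have [C C1 hC] := suppression_bound; have [al /andP[al0 al1] hphi] := phi_powR.
have C0 : 0 <= C := le_trans ler01 C1.
exists (4 * C * C); first by nra.
case: (eqVneq al 0) => [al_0|alN0].
  left=> n a; split=> [i ln|B B0 aB].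
    apply: le_trans (coef_le _ hC n a i ln) _; apply: ler_wpM2r => //; nra.
  have hphi1 m : phi m <= 1.
    by case: m => [|m]; rewrite ?phi0 ?ler01 // hphi // al_0 powRr0.
  apply: le_trans (norm_le_sup _ C1 hC n a B hphi1 B0 aB) _.
  apply: ler_wpM2r => //; nra.
have {}al0 : 0 < al by rewrite lt0r alN0.
right; exists al^-1; first by rewrite invf_ge1.
move=> n a; rewrite invrK.
have [h1 h2] := lp_bounds_nonneg _ C1 hC _ al0 al1 hphi n
  (fun i => `|a i|) (fun=> normr_ge0 _).
split.
  apply: le_trans h1 _; have := norm_abs_le _ hC n a.
  have : 0 <= 2 * C by rewrite mulr_ge0.
  nra.
have := norm_le_abs _ hC n a; have : 0 <= 2 * C by rewrite mulr_ge0.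
nra.
Qed.

End BlockHomogeneousSequences.

(** * Gliding humps and unconditionality *)

Section Humps.

(** Finite sequences extending one another have a common infinite extension. *)
Lemma nested_seq_limit (T : Type) (z : T) (p : nat -> seq T) :
  (forall t, exists r, p t.+1 = p t ++ r) -> (forall t, (t <= size (p t))%N) ->
  exists f : nat -> T, forall t i, (i < size (p t))%N -> f i = nth z (p t) i.
Proof.
move=> pS ps; exists (fun i => nth z (p i.+1) i).
have step t t' i : (t <= t')%N -> (i < size (p t))%N ->
    (i < size (p t'))%N /\ nth z (p t') i = nth z (p t) i.
  elim: t' => [|t' IH]; first by rewrite leqn0 => /eqP ->.
  rewrite leq_eqVlt => /predU1P[->//|]; rewrite ltnS => tt ip.
  have [h1 h2] := IH tt ip; have [r ->] := pS t'.
  by rewrite size_cat nth_cat h1 ltn_addr.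
move=> t i ip; case: (leqP t i.+1) => h; first by have [_ ->] := step _ _ _ h ip.
by have [_ ->] := step _ _ _ (ltnW h) (ps i.+1).
Qed.

Variables (R : realType) (X : completeNormedModType R).

(** A series whose partial sums over the t-th block [M t, M t.+1[ of indices
    are bounded by 2^-t converges. *)
Lemma cvg_series_blocks (M : nat -> nat) (f : nat -> X) :
  M 0%N = 0%N -> (forall t, (M t < M t.+1)%N) ->
  (forall t k, (M t <= k <= M t.+1)%N -> `|\sum_(M t <= i < k) f i| <= 2^-1 ^+ t) ->
  cvgn (series f).
Proof.
move=> M0 MS hf.
have tail d t k : (M t <= k <= M (t + d))%N ->
    `|\sum_(M t <= i < k) f i| <= 2 * 2^-1 ^+ t.
  elim: d t k => [|d IH] t k.
    rewrite addn0 -eqn_leq => /eqP <-; rewrite big_geq // normr0.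
    by rewrite mulr_ge0 // exprn_ge0 // invr_ge0.
  rewrite addnS -addSn => /andP[h1 h2]; case: (leqP k (M t.+1)) => h3.
    apply: le_trans (hf t k _) _; first by rewrite h1.
    by rewrite ler_peMl ?exprn_ge0 ?invr_ge0 // ler1n.
  rewrite (@big_cat_nat _ _ _ (M t.+1)) ?(ltnW h3) ?(ltnW (MS t)) //=.
  apply: le_trans (ler_normD _ _) _.
  have a1 : `|\sum_(M t <= i < M t.+1) f i| <= 2^-1 ^+ t.
    by apply: hf; rewrite leqnn ltnW.
  have a2 := IH t.+1 k; rewrite (ltnW h3) h2 in a2; have {}a2 := a2 isT.
  by rewrite exprS in a2; move: a1 a2; set z := _ ^+ t; lra.
have Mt t : (t <= M t)%N by elim: t => // t IH; exact: leq_ltn_trans IH (MS t).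
have Mmono : {homo M : i j / (i <= j)%N}.
  by apply: homo_leq => [//|i j k|i]; [exact: leq_trans|exact: ltnW].
apply: cauchy_cvg; apply/cauchy_seriesP => eps eps0.
have [t ht] : exists t, 4 * 2^-1 ^+ t < eps :> R.
  have [t Ht] : exists t, (4 / eps : R) < t%:R.
    by exists (Num.Def.archi_bound (4 / eps)); apply: archi_boundP;
      rewrite divr_ge0 // ltW.
  exists t; rewrite exprVn ltr_pdivrMr ?exprn_gt0 // -ltr_pdivrMl // mulrC.
  by apply: lt_trans Ht _; rewrite -natrX ltr_nat ltn_expl.
exists ([set k | (M t <= k)%N], [set k | (M t <= k)%N]).
  by split; exists (M t).
move=> [k l] /= [hk hl].
have bnd j : (M t <= j)%N -> `|\sum_(M t <= i < j) f i| <= 2 * 2^-1 ^+ t.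
  by move=> tj; apply: (tail j); rewrite tj (leq_trans (Mt j)) // Mmono // leq_addl.
case: (leqP k l) => kl; last by rewrite big_geq ?normr0 // ltnW.
have -> : \sum_(k <= i < l) f i = \sum_(M t <= i < l) f i - \sum_(M t <= i < k) f i.
  by rewrite [X in _ = X - _](@big_cat_nat _ _ _ k) //= [RHS]addrC addKr.
have := bnd k hk; have := bnd l hl.
have := ler_normB (\sum_(M t <= i < l) f i) (\sum_(M t <= i < k) f i); lra.
Qed.

(** An unconditional sequence x admits no humps, that is, finite combinations
    lying arbitrarily far out with arbitrarily small initial partial sums and a
    subset sum of norm at least 1/2.  Otherwise successive humps give a
    convergent series, and the permutation that starts each block with the
    selected indices destroys the Cauchy property. *)
Lemma unconditional_no_humps (x : nat -> X) : unconditional x ->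
  ~ (forall (d : R) M, 0 < d -> exists n (b : nat -> R) (A : pred nat),
    (forall k, (k <= n)%N -> `|\sum_(0 <= i < k) b i *: x (M + i)%N| <= d) /\
    2^-1 <= `|\sum_(0 <= i < n | A i) b i *: x (M + i)%N|).
Proof.
move=> x_unc H.
have {}H (tM : nat * nat) : exists c : nat * (nat -> R) * pred nat,
    (forall k, (k <= c.1.1)%N ->
      `|\sum_(0 <= i < k) c.1.2 i *: x (tM.2 + i)%N| <= 2^-1 ^+ tM.1) /\
    2^-1 <= `|\sum_(0 <= i < c.1.1 | c.2 i) c.1.2 i *: x (tM.2 + i)%N|.
  have [|n [b [A h]]] := H (2^-1 ^+ tM.1) tM.2; first by rewrite exprn_gt0 // invr_gt0.
  by exists (n, b, A).
have [g hg] := choice H.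
have [M [M0 MS]] : exists M, M 0%N = 0%N /\
    forall t, M t.+1 = (M t + (g (t, M t)).1.1)%N.
  by exists (fix M t := if t is t'.+1 then (M t' + (g (t', M t')).1.1)%N else 0%N).
pose n t := (g (t, M t)).1.1; pose b t := (g (t, M t)).1.2; pose A t := (g (t, M t)).2.
have MSn t : M t.+1 = (M t + n t)%N := MS t.
have hb t k : (k <= n t)%N -> `|\sum_(0 <= i < k) b t i *: x (M t + i)%N| <= 2^-1 ^+ t.
  exact: (hg (t, M t)).1.
have hA t : 2^-1 <= `|\sum_(0 <= i < n t | A t i) b t i *: x (M t + i)%N|.
  exact: (hg (t, M t)).2.
have n0 t : (0 < n t)%N.
  rewrite lt0n; apply/eqP => nt; have := hA t; rewrite nt big_geq // normr0.
  by rewrite leNgt invr_gt0 ltr0n.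
have Mlt t : (M t < M t.+1)%N by rewrite MSn -addn1 leq_add2l.
have Mt t : (t <= M t)%N by elim: t => // t IH; exact: leq_ltn_trans IH (Mlt t).
(* a collects the coefficients of all the humps, block after block *)
have [q [q0 qS]] : exists q : nat -> seq R, q 0%N = [::] /\
    forall t, q t.+1 = q t ++ mkseq (b t) (n t).
  by exists (fix q t := if t is t'.+1 then q t' ++ mkseq (b t') (n t') else [::]).
have sq t : size (q t) = M t.
  by elim: t => [|t IH]; rewrite ?q0 ?M0 // qS size_cat size_mkseq IH MSn.
have [|t|a ha] := nested_seq_limit _ 0 q; first by move=> t; exists (mkseq (b t) (n t)).
  by rewrite sq.
have aE t i : (i < n t)%N -> a (M t + i)%N = b t i.
  move=> lin; rewrite (ha t.+1) ?sq ?MSn ?ltn_add2l // qS nth_cat sq ltnNge leq_addr /=.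
  by rewrite addKn nth_mkseq.
(* permutation: inside the t-th block, the indices selected by A t come first *)
pose l t := [seq (M t + i)%N |
  i <- [seq i <- iota 0 (n t) | A t i] ++ [seq i <- iota 0 (n t) | ~~ A t i]].
have [p [p0 pS]] : exists p : nat -> seq nat, p 0%N = [::] /\
    forall t, p t.+1 = p t ++ l t.
  by exists (fix p t := if t is t'.+1 then p t' ++ l t' else [::]).
have pp t : perm_eq (p t) (iota 0 (M t)).
  elim: t => [|t IH]; first by rewrite p0 M0.
  rewrite pS MSn iotaD perm_cat // add0n -[X in iota X _]addn0 iotaDl.
  by apply: perm_map; rewrite permEl //; exact: (perm_filterC (A t)).
have sp t : size (p t) = M t by rewrite (perm_size (pp t)) size_iota.
have [|t|s hs] := nested_seq_limit _ 0%N p; first by move=> t; exists (l t).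
  by rewrite sp.
have up t : uniq (p t) by rewrite (perm_uniq (pp t)) iota_uniq.
have Mmono : {homo M : i j / (i <= j)%N}.
  by apply: homo_leq => [//|i j k|i]; [exact: leq_trans|exact: ltnW].
have s_inj : injective s.
  move=> i j; pose t := (maxn i j).+1.
  have it : (i < M t)%N by apply: leq_trans (Mt t); rewrite ltnS leq_maxl.
  have jt : (j < M t)%N by apply: leq_trans (Mt t); rewrite ltnS leq_maxr.
  rewrite (hs t i) ?sp // (hs t j) ?sp // => /eqP; rewrite nth_uniq ?sp //.
  by move/eqP.
have s_surj j : exists i, s i = j.
  have jp : j \in p j.+1.
    by rewrite (perm_mem (pp _)) mem_iota add0n (leq_trans _ (Mt j.+1)).
  by exists (index j (p j.+1)); rewrite (hs j.+1) ?nth_index // index_mem.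
have s_bij : bijective s.
  have [g' hg'] := choice s_surj; exists g' => // i; apply: s_inj; exact: hg'.
have cvg_a : cvgn (series (fun i => a i *: x i)).
  apply: (@cvg_series_blocks M) => // t k /andP[h1 h2].
  rewrite -(subnKC h1) sum_shift; apply: le_trans (hb t (k - M t)%N _); last first.
    by rewrite leq_subLR -MSn.
  rewrite le_eqVlt; apply/orP; left; apply/eqP; congr `|_|.
  apply: eq_big_nat => i /andP[_ ik]; rewrite aE //.
  by rewrite (leq_trans ik) // leq_subLR -MSn.
have /cvg_cauchy/cauchy_seriesP := x_unc a cvg_a s s_bij.
move=> /(_ 2^-1); rewrite invr_gt0 ltr0n => /(_ isT).
move=> [[P Q]] /= [[N1 _ hN1] [N2 _ hN2]] PQ.
pose t := maxn N1 N2; pose r := count (A t) (iota 0 (n t)).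
have PQt : P (M t) /\ Q (M t + r)%N.
  split; [apply: hN1|apply: hN2] => /=; last apply: leq_trans (leq_addr _ _);
    by apply: leq_trans (Mt t); rewrite /t ?leq_maxl ?leq_maxr.
have := PQ (M t, (M t + r)%N) PQt.
rewrite /=; apply/negP; rewrite -leNgt; apply: le_trans (hA t) _.
rewrite le_eqVlt; apply/orP; left; apply/eqP; congr `|_|.
rewrite sum_shift /index_iota subn0 -big_filter.
rewrite (big_nth 0%N) size_filter -/r; apply: eq_big_nat => i /andP[_ ir].
have rn : (r <= n t)%N by rewrite -[n t](size_iota 0) count_size.
have sE : s (M t + i)%N = (M t + nth 0%N [seq j <- iota 0 (n t) | A t j] i)%N.
  rewrite (hs t.+1) ?sp ?MSn ?ltn_add2l ?(leq_trans ir) // pS nth_cat sp.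
  rewrite ltnNge leq_addr /= addKn (nth_map 0%N).
    by rewrite nth_cat size_filter ir.
  by rewrite size_cat size_filter ltn_addr.
rewrite sE aE //.
have : nth 0%N [seq j <- iota 0 (n t) | A t j] i \in [seq j <- iota 0 (n t) | A t j].
  by rewrite mem_nth // size_filter.
by rewrite mem_filter mem_iota => /andP[_].
Qed.

End Humps.

(** * Successive finite sets *)

Section Blocks.

(** The first n sets of c are nonempty, successive, and contained in [M, +oo[.
    Only these n sets are constrained. *)
Definition blocks (n M : nat) (c : nat -> {fset nat}) : Prop :=
  [/\ forall i, (i < n)%N -> c i != fset0,
      forall i k, (i < n)%N -> k \in c i -> (M <= k)%N &
      forall i, (i.+1 < n)%N -> fset_before (c i) (c i.+1)].

Lemma blocks_le n M M' c : (M' <= M)%N -> blocks n M c -> blocks n M' c.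
Proof.
move=> MM [h1 h2 h3]; split=> // i k lin kc.
exact: leq_trans MM (h2 i k lin kc).
Qed.

Lemma blocks_singletons n M (k : nat -> nat) : {homo k : i j / (i < j)%N} ->
  (forall i, (M <= k i)%N) -> blocks n M (fun i => [fset k i]%fset).
Proof.
move=> hk Mk; split=> [i _|i j _|i _ j l].
- by apply/fset0Pn; exists (k i); rewrite inE.
- by rewrite inE => /eqP ->.
- by rewrite !inE => /eqP -> /eqP ->; apply: hk.
Qed.

Lemma fset_bound (F : {fset nat}) : exists M, forall k, k \in F -> (k < M)%N.
Proof.
by exists (\max_(k <- F) k).+1 => k kF; rewrite ltnS (leq_bigmax_seq (F := id)).
Qed.

(** Finite runs of successive sets, available arbitrarily far out, can be
    concatenated into one infinite sequence of successive sets. *)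
Lemma concat_blocks n (Q : (nat -> {fset nat}) -> Prop) : (0 < n)%N ->
  (forall M, exists2 c, blocks n M c & Q c) ->
  exists w : nat -> {fset nat},
    [/\ forall i, w i != fset0, forall i, fset_before (w i) (w i.+1) &
        forall t, exists2 c, Q c & forall i, (i < n)%N -> w (t * n + i)%N = c i].
Proof.
move=> n0 H.
have {}H M : exists c, blocks n M c /\ Q c by have [c] := H M; exists c.
have [f hf] := choice H.
have [bd hbd] := choice fset_bound.
pose g := fix g t := if t is t'.+1 then bd (f (g t') n.-1) else 0%N.
pose w i := f (g (i %/ n)%N) (i %% n)%N.
have wE t i : (i < n)%N -> w (t * n + i)%N = f (g t) i.
  by move=> lin; rewrite /w divnMDl // modnMDl modn_small // divn_small // addn0.
exists w; split=> [i|i|t]; last by exists (f (g t)); [exact: (hf _).2|exact: wE].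
  by have [[h _ _] _] := hf (g (i %/ n)%N); rewrite /w h // ltn_mod.
rewrite (divn_eq i n); set t := (i %/ n)%N; set r := (i %% n)%N.
have rn : (r < n)%N by rewrite ltn_mod.
rewrite wE //; case: (ltnP r.+1 n) => h.
  by rewrite -addnS wE //; have [[_ _ hb] _] := hf (g t); exact: hb.
have -> : (t * n + r).+1 = (t.+1 * n + 0)%N by lia.
rewrite wE // => a b ha hb; have [[_ hM _] _] := hf (g t.+1).
apply: leq_trans (hM 0%N b n0 hb) => /=; apply: hbd.
by have -> : n.-1 = r by lia.
Qed.

Lemma successive_ge (w : nat -> {fset nat}) :
  (forall i, w i != fset0) -> (forall i, fset_before (w i) (w i.+1)) ->
  forall i k, k \in w i -> (i <= k)%N.
Proof.
move=> w0 wb; elim=> // i IH k hk; have /fset0Pn[m hm] := w0 i.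
by apply: leq_ltn_trans (IH m hm) (wb i m k hm hk).
Qed.

End Blocks.

(** * The common spreading model *)

Section SpreadingModelOfBlocks.
Variables (R : realType) (X : completeNormedModType R) (x : nat -> X).
Hypothesis nccb_good : forall y : nat -> X, nccb x y -> good y.

(** The vector that a finite set of indices contributes to an NCCB sequence; it
    is 0 when the sum over the set vanishes. *)
Definition normalized_block (F : {fset nat}) : X :=
  `|\sum_(k <- F) x k|^-1 *: \sum_(k <- F) x k.
Let u := normalized_block.

Variables (E : completeNormedModType R) (e : nat -> E).

(** Coefficients outside [-1, 1] are allowed, at the price of a threshold that
    depends on them. *)
Lemma spreading_model_limit (y : nat -> X) : spreading_model y e ->
  forall n (a : nat -> R) (eps : R), 0 < eps ->
  exists N, forall k : nat -> nat,
  (forall i, (N <= k i)%N) -> {homo k : i j / (i < j)%N} ->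
  `| `|\sum_(0 <= i < n) a i *: y (k i)| - `|\sum_(0 <= i < n) a i *: e i| | <= eps.
Proof.
move=> [_ _ _ lim] n a eps eps0; pose B := 1 + \sum_(i < n) `|a i|.
have B0 : 0 < B by rewrite ltr_pwDl // sumr_ge0.
have [N hN] := lim (eps / B) n (divr_gt0 eps0 B0); exists N => k Nk hk.
have := hN (fun i => a i / B) (fun i => k i).
have ha (i : 'I_n) : -1 <= a i / B <= 1.
  rewrite -ler_norml normrM normfV (gtr0_norm B0) ler_pdivrMr // mul1r.
  by rewrite /B (bigD1 i) //= addrCA lerDl addr_ge0 // sumr_ge0.
move=> /(_ ha) H; have inc : increasing_above N (fun i : 'I_n => k i).
  by split=> [i|i j]; [exact: Nk|exact: hk].
have {}H := H inc.
have sc (V : normedModType R) (z : nat -> V) : `|\sum_(i < n) (a i / B) *: z i| =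
    `|\sum_(0 <= i < n) a i *: z i| / B.
  rewrite big_mkord; under eq_bigr do rewrite mulrC -scalerA.
  by rewrite -scaler_sumr normrZ mulrC normfV (gtr0_norm B0).
move: H; rewrite (sc X (fun i => y (k i))) (sc E e).
rewrite -mulrBl normrM normfV (gtr0_norm B0).
by rewrite ler_pdivrMr // divfK ?gt_eqF.
Qed.

Variables (y0 : nat -> X).
Hypotheses (nccb_y0 : nccb x y0) (model_y0 : spreading_model y0 e).

(** All blocks of x generate the same spreading model: successive sets far
    enough out give normalized blocks whose combinations have norm close to
    that of e.  Otherwise, runs of y0 alternating with bad runs form an NCCB
    sequence along which the norms do not converge. *)
Lemma blocks_limit n (a : nat -> R) (eps : R) : 0 < eps ->
  exists M, forall c, blocks n M c ->
  `| `|\sum_(0 <= i < n) a i *: u (c i)| - `|\sum_(0 <= i < n) a i *: e i| | <= eps.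
Proof.
move=> eps0; case: (posnP n) => [->|n0].
  by exists 0%N => c _; rewrite !big_geq // !normr0 subrr normr0 ltW.
set N := `|\sum_(0 <= i < n) a i *: e i|.
apply: contrapT => H.
have {}H M : exists2 c, blocks n M c &
    eps < `| `|\sum_(0 <= i < n) a i *: u (c i)| - N|.
  apply: contrapT => H'; apply: H; exists M => c bc; rewrite leNgt; apply/negP => h.
  by apply: H'; exists c.
have [F [F0 Fb Fy]] := nccb_y0.
have eps4 : 0 < eps / 4 by rewrite divr_gt0.
have [N0 hN0] := spreading_model_limit _ model_y0 n a _ eps4.
pose Q (c : nat -> {fset nat}) :=
  `| `|\sum_(0 <= i < n) a i *: u (c i)| - N| <= eps / 4 /\
  eps < `| `|\sum_(0 <= i < n) a i *: u (c (n + i)%N)| - N|.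
have HQ M : exists2 c, blocks (n + n) M c & Q c.
  pose K := maxn N0 M.
  have [M2 hM2] := fset_bound (F (K + n.-1)%N).
  have [c [c0 cM cb] cbad] := H (maxn M M2).
  (* a run of y0 followed by a bad run *)
  exists (fun i => if (i < n)%N then F (K + i)%N else c (i - n)%N).
    split=> [i lin|i k lin|i lin].
    - by case: ltnP => h; [exact: F0|apply: c0; lia].
    - case: ltnP => h hk.
        have := successive_ge F F0 Fb _ _ hk; rewrite /K; lia.
      have := cM (i - n)%N k (_ : (i - n < n)%N) hk; lia.
    - case: (ltnP i.+1 n) => h1.
        by rewrite ltnW // addnS; apply: Fb.
      case: (ltnP i n) => h2.
        move=> p q hp hq; have ei : i = n.-1 by lia.
        apply: leq_trans (hM2 p _) _; first by rewrite -ei.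
        have := cM (i.+1 - n)%N q (_ : (i.+1 - n < n)%N) hq; lia.
      by rewrite subSn //; apply: cb; lia.
  split.
    under eq_big_nat => i /andP[_ lin] do rewrite lin /u /normalized_block -Fy.
    apply: (hN0 (addn K)) => [i|i j ij]; first by rewrite /K; lia.
    by rewrite ltn_add2l.
  under eq_big_nat => i _ do rewrite ltnNge leq_addr /= addKn.
  exact: cbad.
have [w [w0 wb wQ]] := concat_blocks _ Q (ltn_addr n n0) HQ.
have /nccb_good gw : nccb x (fun i => u (w i)) by exists w.
have [l hl] := gw n (fun i => a i); have [N1 {}hl] := hl _ eps4.
have [c [c1 c2] wc] := wQ N1.
have H1 : `| `|\sum_(0 <= i < n) a i *: u (c i)| - l| <= eps / 4.
  under eq_big_nat => i /andP[_ lin] do rewrite -wc ?ltn_addr //.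
  rewrite big_mkord; apply: (hl (fun i => (N1 * (n + n) + i)%N)).
  by split=> [i|i j ij]; [nia|rewrite ltn_add2l].
have H2 : `| `|\sum_(0 <= i < n) a i *: u (c (n + i)%N)| - l| <= eps / 4.
  under eq_big_nat => i /andP[_ lin] do rewrite -wc ?ltn_add2l //.
  rewrite big_mkord; apply: (hl (fun i => (N1 * (n + n) + (n + i))%N)).
  by split=> [i|i j ij]; [nia|rewrite !ltn_add2l].
move: H1 H2 c1 c2; rewrite !ler_norml lter_normr; lra.
Qed.

Hypothesis x_semi : semi_normalized x.

Lemma semi_normalized_bounds : exists al be : R,
  0 < al /\ forall i, al <= `|x i| <= be.
Proof.
have [] := x_semi; set I := ereal_inf _; set S := ereal_sup _ => I0 S0.
have Ix i : (I <= `|x i|%:E)%E by apply: ereal_inf_lbound; exists i.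
have Sx i : (`|x i|%:E <= S)%E by apply: ereal_sup_ubound; exists i.
exists (fine I), (fine S).
have If : I \is a fin_num.
  by rewrite ge0_fin_numE ?(ltW I0) // (le_lt_trans (Ix 0%N)) ?ltry.
have Sf : S \is a fin_num.
  by rewrite ge0_fin_numE // (le_trans (ltW I0)) // (le_trans (Ix 0%N)).
split=> [|i].
  exact: fine_gt0 (introT andP (conj I0 (le_lt_trans (Ix 0%N) (ltry _)))).
by rewrite -!lee_fin !fineK // Ix Sx.
Qed.

(** The norms of x need not converge, but they have a positive cluster point. *)
Lemma norm_cluster : exists2 c : R, 0 < c &
  forall (d : R) M, 0 < d -> exists2 k, (M <= k)%N & `| `|x k| - c| <= d.
Proof.
have [al [be [al0 xb]]] := semi_normalized_bounds.
have /(_ ((fun k => `|x k|) @ \oo)) : compact `[al, be] by exact: segment_compact.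
case=> [|c []].
- by exists 0%N => // k _ /=; rewrite in_itv /= xb.
rewrite /= in_itv /= => /andP[alc _] cc.
exists c => [|d M d0]; first exact: lt_le_trans al0 alc.
have [|z []] := cc [set z | exists2 k, (M <= k)%N & z = `|x k|] (ball c d) _
  (nbhsx_ballx c _ d0).
  by exists M => // k /= Mk; exists k.
move=> [k Mk ->]; rewrite /ball /= => h; exists k => //.
by rewrite distrC ltW.
Qed.

Lemma norm_cluster_indices (c : R) :
  (forall (d : R) M, 0 < d -> exists2 k, (M <= k)%N & `| `|x k| - c| <= d) ->
  forall (d : R) M, 0 < d -> exists k : nat -> nat,
    [/\ {homo k : i j / (i < j)%N}, forall i, (M <= k i)%N &
        forall i, `| `|x (k i)| - c| <= d].
Proof.
move=> hc d M d0.
have {}hc N : exists k, (N <= k)%N /\ `| `|x k| - c| <= d.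
  by have [k] := hc d N d0; exists k.
have [nx hnx] := choice hc.
pose k := fix k i := if i is i'.+1 then nx (k i').+1 else nx M.
have kS i : (k i < k i.+1)%N by exact: (hnx _).1.
exists k; split=> [|i|[|i]]; last 2 first.
- exact: (hnx _).2.
- exact: (hnx _).2.
- by apply: homo_ltn => //; exact: ltn_trans.
- by elim: i => [|i IH]; [exact: (hnx M).1|exact: leq_trans IH (ltnW (kS i))].
Qed.

(** The normalized vectors of x are its blocks over singletons. *)
Let v k := u [fset k]%fset.

Lemma normalized_termE k : v k = `|x k|^-1 *: x k.
Proof. by rewrite /v /u /normalized_block big_seq_fset1. Qed.

Lemma x_neq0 k : `|x k| != 0.
Proof.
have [al [be [al0 xb]]] := semi_normalized_bounds.
by have /andP[h _] := xb k; rewrite gt_eqF // (lt_le_trans al0).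
Qed.

Lemma norm_normalized_term k : `|v k| = 1.
Proof. by rewrite normalized_termE normrZ normfV normr_id mulVf ?x_neq0. Qed.

Lemma normalized_termK k : x k = `|x k| *: v k.
Proof. by rewrite normalized_termE scalerA mulfV ?x_neq0 // scale1r. Qed.

Lemma normalized_blockK (F : {fset nat}) :
  \sum_(k <- F) x k = `|\sum_(k <- F) x k| *: u F.
Proof.
rewrite /u /normalized_block; have [->|h] := eqVneq (\sum_(k <- F) x k) 0.
  by rewrite normr0 scale0r.
by rewrite scalerA mulfV ?scale1r // normr_eq0.
Qed.

Lemma norm_normalized_block (F : {fset nat}) : `|u F| <= 1.
Proof.
rewrite /u /normalized_block normrZ normfV normr_id.
have [->|h] := eqVneq (`|\sum_(k <- F) x k|) 0; first by rewrite mulr0.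
by rewrite mulVf.
Qed.

Let phi m := `|\sum_(0 <= i < m) e i|.

Lemma model_spread (k : nat -> nat) : {homo k : i j / (i < j)%N} ->
  forall n (a : nat -> R),
  `|\sum_(0 <= i < n) a i *: e (k i)| = `|\sum_(0 <= i < n) a i *: e i|.
Proof.
move=> hk n a; have [_ _ [_ sp] _] := model_y0.
have := sp k hk n (fun i => a i); rewrite invr1 !mul1r !big_mkord => -[h1 h2].
by apply/le_anti; rewrite h1 h2.
Qed.

Lemma block_limits n (a : nat -> R) (eps : R) : 0 < eps ->
  exists M, forall c M', (M <= M')%N -> blocks n M' c ->
  `| `|\sum_(0 <= i < n) a i *: u (c i)| - `|\sum_(0 <= i < n) a i *: e i| | <= eps.
Proof.
move=> eps0; have [M hM] := blocks_limit n a eps eps0; exists M => c M' MM bc.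
by apply: hM; exact: (blocks_le _ _ _ _ MM bc).
Qed.

(** The spreading model is isometric to its normalized constant coefficient
    blocks.  Along indices where the norms of x are close to c, the sum of x over
    a finite set is close to c times the sum of the normalized vectors v, hence
    the block of x has norm close to c * phi m, and its normalization generates
    the same spreading model. *)
Lemma model_block (s : nat -> nat) : {homo s : i j / (i < j)%N} ->
  forall n (a : nat -> R),
  `|\sum_(0 <= j < n) a j *: \sum_(s j <= i < s j.+1) e i| =
  `|\sum_(0 <= j < n) (a j * phi (s j.+1 - s j)) *: e j|.
Proof.
move=> hs n a; have [c c0 hc] := norm_cluster.
pose m j := (s j.+1 - s j)%N.
set L := `|_|; set L' := `|_|; apply/eqP; rewrite -subr_eq0; apply/eqP.
pose K0 := \sum_(0 <= j < n) `|a j| * (2 * (m j)%:R + c).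
apply: (@eq0_of_le_small _ _ ((2 * c + K0) / c)) => d d0.
pose b i := \sum_(0 <= j < n | (s j <= i < s j.+1)%N) a j.
have [M1 hM1] := block_limits (s n) b d d0.
have [M2 hM2] : exists M, forall j, (j < n)%N -> forall k M', (M <= M')%N ->
    blocks (m j) M' k ->
    `| `|\sum_(0 <= i < m j) u (k i)| - phi (m j)| <= d.
  apply: finite_limits => [j M M' MM H k M'' MM' bk|j].
    by apply: H bk; exact: leq_trans MM'.
  have [M hM] := block_limits (m j) (fun=> 1) d d0; exists M => k M' MM bk.
  have := hM k M' MM bk; under eq_bigr do rewrite scale1r.
  by under [X in _ - `|X|]eq_bigr do rewrite scale1r.
have [M3 hM3] := block_limits n (fun j => a j * phi (m j)) d d0.
pose M := maxn M1 (maxn M2 M3).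
have [k [hk Mk kc]] := norm_cluster_indices _ hc _ M d0.
pose V j := \sum_(s j <= i < s j.+1) v (k i).
pose F j := [fset k i | i in index_iota (s j) (s j.+1)]%fset.
pose W j := \sum_(l <- F j) x l.
have k_inj : injective k.
  move=> i j kij; case: (ltngtP i j) => // /hk; by rewrite kij ltnn.
have WE j : W j = \sum_(s j <= i < s j.+1) x (k i).
  rewrite /W big_imfset /=; last by move=> p q _ _; exact: k_inj.
  by apply: perm_big; apply: uniq_perm;
    rewrite ?undup_uniq ?iota_uniq // => l; rewrite mem_undup.
have hL : `| `|\sum_(0 <= j < n) a j *: V j| - L| <= d.
  rewrite /L -!(sum_interval_coef _ _ _ _ _ _ hs).
  apply: (hM1 (fun i => [fset k i]%fset) M); first by rewrite leq_maxl.
  exact: blocks_singletons.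
have hV j : (j < n)%N -> `| `|V j| - phi (m j)| <= d.
  move=> jn; have := hM2 j jn (fun i => [fset k (s j + i)%N]%fset) M.
  rewrite /V -(subnKC (ltnW (hs _ _ (ltnSn j)))) -/(m j) (sum_shift (s j)); apply.
    by rewrite /M; lia.
  apply: (@blocks_singletons _ _ (fun i => k (s j + i)%N)) => // p q pq.
  by apply: hk; rewrite ltn_add2l.
have hL' : `| `|\sum_(0 <= j < n) (a j * phi (m j)) *: u (F j)| - L'| <= d.
  apply: (hM3 F M); first by rewrite /M; lia.
  split=> [i _|i l _|i _ p q].
  - apply/fset0Pn; exists (k (s i)); apply/imfsetP; exists (s i) => //=.
    by rewrite mem_index_iota leqnn hs.
  - by move=> /imfsetP[p _ ->].
  - move=> /imfsetP[p' /= hp ->] /imfsetP[q' /= hq ->]; apply: hk.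
    by move: hp hq; rewrite !mem_index_iota; lia.
have hWV j : `|W j - c *: V j| <= (m j)%:R * d.
  rewrite WE scaler_sumr -sumrB; apply: le_trans (ler_norm_sum _ _ _) _.
  rewrite mulr_natl -sumr_const_nat; apply: ler_sum => i _.
  by rewrite {1}normalized_termK -scalerBl normrZ norm_normalized_term mulr1.
have hu j : (j < n)%N ->
    `|(c * phi (m j)) *: u (F j) - c *: V j| <= (2 * (m j)%:R + c) * d.
  move=> jn; have -> : (c * phi (m j)) *: u (F j) - c *: V j =
      ((c * phi (m j) - c * `|V j|) *: u (F j) + (c * `|V j| - `|W j|) *: u (F j)) +
      (W j - c *: V j).
    have Wu : `|W j| *: u (F j) = W j by rewrite -normalized_blockK.
    by rewrite -scalerDl !addrA subrK scalerBl Wu subrK.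
  apply: le_trans (ler_normD _ _) _.
  have h1 : `|(c * phi (m j) - c * `|V j|) *: u (F j)| <= c * d.
    rewrite normrZ -mulrBr normrM (gtr0_norm c0) -[leRHS]mulr1; apply: ler_pM => //.
    - by rewrite mulr_ge0 // ltW.
    - by rewrite ler_pM2l // distrC hV.
    - exact: norm_normalized_block.
  have h2 : `|(c * `|V j| - `|W j|) *: u (F j)| <= (m j)%:R * d.
    rewrite normrZ -[leRHS]mulr1; apply: ler_pM => //;
      last exact: norm_normalized_block.
    rewrite -{1}(gtr0_norm c0) -normrZ; apply: le_trans (ler_dist_dist _ _) _.
    by rewrite distrC.
  have h3 := hWV j.
  have := ler_normD ((c * phi (m j) - c * `|V j|) *: u (F j))
    ((c * `|V j| - `|W j|) *: u (F j)).
  lra.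
have : `| c * `|\sum_(0 <= j < n) (a j * phi (m j)) *: u (F j)| -
          c * `|\sum_(0 <= j < n) a j *: V j| | <= K0 * d.
  rewrite -{1 2}(gtr0_norm c0) -!normrZ; apply: le_trans (ler_dist_dist _ _) _.
  rewrite !scaler_sumr -sumrB /K0 mulr_suml; apply: le_trans (ler_norm_sum _ _ _) _.
  rewrite !big_nat; apply: ler_sum => j /andP[_ jn].
  have -> : c *: ((a j * phi (m j)) *: u (F j)) - c *: (a j *: V j) =
      a j *: ((c * phi (m j)) *: u (F j) - c *: V j).
    by rewrite scalerBr !scalerA mulrCA [a j * c]mulrC.
  by rewrite normrZ -mulrA ler_wpM2l // hu.
rewrite -mulrBr normrM (gtr0_norm c0) mulrAC -mulrA => hc1.
rewrite mulrC mulrAC ler_pdivlMr //.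
move: hL hL' hc1; set p := `|\sum_(0 <= j < n) (a j * phi (m j)) *: u (F j)|.
set q := `|\sum_(0 <= j < n) a j *: V j| => hL hL' hc1.
have : `|L - L'| <= d + `|p - q| + d.
  have -> : L - L' = - (q - L) - (p - q) + (p - L') by ring.
  apply: le_trans (ler_normD _ _) _; apply: lerD => //.
  by apply: le_trans (ler_normB _ _) _; rewrite normrN lerD.
nra.
Qed.

(** If the spreading model had no bound on subset sums in terms of initial partial
    sums, then x would admit humps: copy a bad combination to consecutive
    normalized vectors of x far enough out. *)
Lemma hump_chunk : (forall C : R, 0 <= C -> exists n (a : nat -> R) (A : pred nat) B,
    (forall k, (k <= n)%N -> `|\sum_(0 <= i < k) a i *: e i| <= B) /\
    C * B < `|\sum_(0 <= i < n | A i) a i *: e i|) ->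
  forall (d : R) M, 0 < d -> exists n (b : nat -> R) (A : pred nat),
    (forall k, (k <= n)%N -> `|\sum_(0 <= i < k) b i *: x (M + i)%N| <= d) /\
    2^-1 <= `|\sum_(0 <= i < n | A i) b i *: x (M + i)%N|.
Proof.
move=> H d M d0; have [|n [a [A [B [aB AB]]]]] := H (2 / d).
  by rewrite divr_ge0 // ltW.
have B0 : 0 <= B by have := aB 0%N isT; rewrite big_geq // normr0.
set D := `|_| in AB.
have D0 : 0 < D by apply: le_lt_trans AB; rewrite mulr_ge0 // divr_ge0 // ltW.
pose a' i := a i / D.
have a'D (P : pred nat) k : `|\sum_(0 <= i < k | P i) a' i *: e i| =
    `|\sum_(0 <= i < k | P i) a i *: e i| / D.
  rewrite /a'; under eq_bigr do rewrite mulrC -scalerA.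
  by rewrite -scaler_sumr normrZ normfV (gtr0_norm D0) mulrC.
have small k : (k <= n)%N -> `|\sum_(0 <= i < k) a' i *: e i| <= d / 2.
  move=> kn; rewrite a'D ler_pdivrMr //; apply: le_trans (aB k kn) _.
  by move: AB; rewrite -/D mulrAC ltr_pdivrMr // => /ltW;
    rewrite mulrAC ler_pdivlMr // mulrC [D * d]mulrC.
have d2 : 0 < d / 2 by rewrite divr_gt0.
have [M1 hM1] : exists M1, forall k, (k < n.+1)%N ->
    forall c M', (M1 <= M')%N -> blocks k M' c ->
    `| `|\sum_(0 <= i < k) a' i *: u (c i)| -
       `|\sum_(0 <= i < k) a' i *: e i| | <= d / 2.
  apply: finite_limits => [j M1 M2 M12 h c M' MM' bc|j]; last exact: block_limits.
  by apply: h bc; exact: leq_trans MM'.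
have h2 : 0 < 2^-1 :> R by rewrite invr_gt0.
have [M2 hM2] := block_limits n (fun i => if A i then a' i else 0) _ h2.
pose M' := maxn M (maxn M1 M2); pose q := (M' - M)%N.
have MM : (M + q)%N = M' by rewrite /q /M'; lia.
have bs k : blocks k M' (fun i => [fset (M' + i)%N]%fset).
  by apply: (@blocks_singletons _ _ (addn M')) => [i j|i]; rewrite ?ltn_add2l // leq_addr.
(* the copy starts at M' = M + q; the first q coefficients are padding *)
pose b i := if (i < q)%N then 0 else a' (i - q)%N / `|x (M + i)%N|.
have bE (P : pred nat) k : \sum_(0 <= i < q + k | P i) b i *: x (M + i)%N =
    \sum_(0 <= i < k | P (q + i)%N) a' i *: v (M' + i)%N.
  rewrite (@big_cat_nat _ _ _ q) //=; last by rewrite leq_addr.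
  rewrite big1_seq ?add0r; last first.
    by move=> i; rewrite mem_index_iota /b => /andP[_ /andP[_ ->]]; rewrite scale0r.
  rewrite big_mkcond sum_shift [RHS]big_mkcond /=; apply: eq_bigr => i _.
  case: ifP => // _; rewrite /b ltnNge leq_addr /= addKn addnA MM.
  by rewrite normalized_termE scalerA.
exists (q + n)%N, b, (fun i => A (i - q)%N); split=> [k kn|].
  case: (leqP q k) => qk; last first.
    rewrite big1_seq ?normr0 ?ltW // => i.
    rewrite mem_index_iota => /andP[_ /andP[_ ik]].
    by rewrite /b (ltn_trans ik qk) scale0r.
  rewrite -(subnKC qk) bE; have kn' : (k - q <= n)%N by lia.
  have := hM1 (k - q)%N kn' (fun i => [fset (M' + i)%N]%fset) M' _ (bs _).
  have -> : (M1 <= M')%N by rewrite /M'; lia.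
  have := small _ kn'; rewrite -/v => s1 /(_ isT); rewrite ler_norml; lra.
rewrite bE; under eq_bigl do rewrite addKn.
have := hM2 (fun i => [fset (M' + i)%N]%fset) M' _ (bs _).
have -> : (M2 <= M')%N by rewrite /M'; lia.
move=> /(_ isT).
have ifE (V : lmodType R) (f : nat -> V) :
    \sum_(0 <= i < n) (if A i then a' i else 0) *: f i =
    \sum_(0 <= i < n | A i) a' i *: f i.
  by rewrite [RHS]big_mkcond; apply: eq_bigr => i _; case: (A i); rewrite ?scale0r.
rewrite !ifE a'D -/D divff ?gt_eqF // ler_norml -/v.
move=> /andP[+ _]; lra.
Qed.

Hypothesis x_unc : unconditional x.

Lemma model_hump : exists2 C : R, 0 <= C & forall n (a : nat -> R) (A : pred nat) B,
  (forall k, (k <= n)%N -> `|\sum_(0 <= i < k) a i *: e i| <= B) ->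
  `|\sum_(0 <= i < n | A i) a i *: e i| <= C * B.
Proof.
apply: contrapT => H; apply: (unconditional_no_humps _ _ _ x_unc) => d M.
apply: hump_chunk => C C0; apply: contrapT => H'; apply: H; exists C => // n a A B aB.
rewrite leNgt; apply/negP => h; apply: H'; by exists n, a, A, B.
Qed.

Lemma model_dichotomy : exists2 C : R, 1 <= C &
  (forall n (a : nat -> R),
    (forall i, (i < n)%N -> `|a i| <= C * `|\sum_(0 <= i < n) a i *: e i|) /\
    (forall B, 0 <= B -> (forall i, (i < n)%N -> `|a i| <= B) ->
      `|\sum_(0 <= i < n) a i *: e i| <= C * B)) \/
  (exists2 p : R, 1 <= p & forall n (a : nat -> R),
    let T := (\sum_(0 <= i < n) `|a i| `^ p) `^ p^-1 in
    T <= C * `|\sum_(0 <= i < n) a i *: e i| /\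
    `|\sum_(0 <= i < n) a i *: e i| <= C * T).
Proof.
have [_ e_norm _ _] := model_y0.
exact: block_homogeneous_dichotomy e_norm model_spread model_block model_hump.
Qed.

End SpreadingModelOfBlocks.

(** All NCCB sequences that generate a spreading model generate the same one. *)
Lemma spreading_models_agree (R : realType) (X : completeNormedModType R) (x : nat -> X)
    (nccb_good : forall y : nat -> X, nccb x y -> good y)
    (E E' : completeNormedModType R) (e : nat -> E) (e' : nat -> E') (y y' : nat -> X) :
  nccb x y -> spreading_model y e -> nccb x y' -> spreading_model y' e' ->
  forall n (a : nat -> R),
  `|\sum_(0 <= i < n) a i *: e' i| = `|\sum_(0 <= i < n) a i *: e i|.
Proof.
move=> ny sy ny' sy' n a; apply/eqP; rewrite -subr_eq0; apply/eqP.
apply: (@eq0_of_le_small _ _ 2) => d d0.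
have [M hM] := blocks_limit _ _ _ nccb_good _ _ _ ny sy n a d d0.
have [N hN] := spreading_model_limit _ _ _ _ _ sy' n a d d0.
have [F [F0 Fb Fy]] := ny'; pose K := maxn M N.
have bK : blocks n M (fun i => F (K + i)%N).
  split=> [i _|i k _ hk|i _]; first exact: F0.
    by have := successive_ge F F0 Fb _ _ hk; rewrite /K; lia.
  by rewrite addnS; exact: Fb.
have {hM} := hM _ bK; under eq_bigr do rewrite /normalized_block -Fy.
have : `| `|\sum_(0 <= i < n) a i *: y' (K + i)%N| -
          `|\sum_(0 <= i < n) a i *: e' i| | <= d.
  apply: (hN (addn K)) => [i|i j ij]; last by rewrite ltn_add2l.
  exact: leq_trans (leq_maxr M N) (leq_addr _ _).
by rewrite !ler_norml => /andP[h1 h2] /andP[h3 h4]; apply/andP; split; lra.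
Qed.

(** * Norms of finite combinations of unit vectors *)

Section UnitVectorNorms.
Variables (R : realType) (n : nat) (a : nat -> R).

Let w : nat -> R^o := \sum_(i < n) a i *: @unit_vector R i.

Lemma unit_vector_sumE j : w j = if (j < n)%N then a j else 0.
Proof.
rewrite /w fct_sumE.
have -> : \sum_(i < n) (a i *: @unit_vector R i) j = \sum_(0 <= i < n | i == j) a i.
  rewrite big_mkord [RHS]big_mkcond /=; apply: eq_bigr => i _.
  rewrite /unit_vector /GRing.scale /= /GRing.scale /=.
  by case: eqP => _; rewrite ?mulr1 ?mulr0.
by rewrite big_nat1_eq leq0n.
Qed.

Lemma c0_norm_ub j : `|w j| <= c0_norm w.
Proof.
apply: sup_upper_bound; last by exists j.
split; first by exists `|w 0%N|, 0%N.
exists (\sum_(0 <= i < n) `|a i|) => _ [l _ <-]; rewrite unit_vector_sumE.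
case: ifP => ln; last by rewrite normr0 sumr_ge0.
rewrite (big_rem l) /=; last by rewrite mem_index_iota.
by rewrite lerDl sumr_ge0.
Qed.

Lemma c0_norm_ge i : (i < n)%N -> `|a i| <= c0_norm w.
Proof. by move=> ln; have := c0_norm_ub i; rewrite unit_vector_sumE ln. Qed.

Lemma c0_norm_ge0 : 0 <= c0_norm w.
Proof. exact: le_trans (c0_norm_ub 0). Qed.

Lemma c0_norm_le B : 0 <= B -> (forall i, (i < n)%N -> `|a i| <= B) -> c0_norm w <= B.
Proof.
move=> B0 aB; apply: ge_sup; first by exists `|w 0%N|, 0%N.
move=> _ [j _ <-]; rewrite unit_vector_sumE.
by case: ifP => jn; [exact: aB|rewrite normr0].
Qed.

Lemma lp_normE p : 0 < p ->
  lp_norm p w = (\sum_(0 <= i < n) `|a i| `^ p) `^ p^-1.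
Proof.
move=> p0; rewrite /lp_norm Lnorm_counting //.
rewrite (nneseries_split 0 n) => [|k _]; last exact: poweR_ge0.
rewrite add0n eseries0 ?adde0 => [|k nk _] /=; last first.
  by rewrite unit_vector_sumE ltnNge nk /= normr0 powR0 ?gt_eqF.
under eq_big_nat => i /andP[_ ln] do rewrite /= unit_vector_sumE ln.
by rewrite sumEFin poweR_EFin.
Qed.

End UnitVectorNorms.

(** Equivalence can be tested on coefficients indexed by all of nat. *)
Lemma equivalent_of_nat_coef (R : realType) (U V : lmodType R) (nU : U -> R)
    (nV : V -> R) (C : R) (f : nat -> U) (g : nat -> V) :
  (forall n (a : nat -> R),
    C^-1 * nV (\sum_(i < n) a i *: g i) <= nU (\sum_(i < n) a i *: f i) /\
    nU (\sum_(i < n) a i *: f i) <= C * nV (\sum_(i < n) a i *: g i)) ->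
  equivalent nU nV C f g.
Proof.
move=> H n a; pose a' j := oapp a 0 (insub j : option 'I_n).
have a'E i : a' (val i) = a i by rewrite /a' valK.
have := H n a'; under eq_bigr do rewrite a'E.
by under [X in nU X]eq_bigr do rewrite a'E.
Qed.

Theorem theorem4p4 (R : realType) (X : completeNormedModType R) (x : nat -> X)
    (x_basic : basic_sequence x) (x_unc : unconditional x)
    (x_semi : semi_normalized x)
    (nccb_good : forall y : nat -> X, nccb x y -> good y) :
  exists nrm : (nat -> R^o) -> R,
    (nrm = @c0_norm R \/ exists2 p : R, 1 <= p & nrm = lp_norm p) /\
    exists2 C : R, 1 <= C &
      forall y : nat -> X, nccb x y ->
      forall (E : completeNormedModType R) (e : nat -> E),
        spreading_model y e ->
        equivalent (fun v : E => `|v|) nrm C e (@unit_vector R).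
Proof.
have [[y0 [ny0 [E0 [e0 sy0]]]]|none] := pselect (exists y0, nccb x y0 /\
    exists (E0 : completeNormedModType R) (e0 : nat -> E0),
    spreading_model y0 e0); last first.
  exists (@c0_norm R); split; first by left.
  by exists 1 => // y ny E e sy; case: none; exists y; split=> //; exists E, e.
have agree y E e ny sy :=
  spreading_models_agree _ _ _ nccb_good E0 E e0 e y0 y ny0 sy0 ny sy.
have [C C1 dich] := model_dichotomy _ _ _ nccb_good _ _ _ ny0 sy0 x_semi x_unc.
have C0 : 0 < C := lt_le_trans ltr01 C1.
case: dich => [c0|[p p1 lp]].
  exists (@c0_norm R); split; first by left.
  exists C => // y ny E e sy; apply: equivalent_of_nat_coef => n a.
  have [lo up] := c0 n a.
  rewrite -(big_mkord xpredT (fun i => a i *: e i)) (agree y E e ny sy).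
  split; last by apply: up; [exact: c0_norm_ge0|exact: c0_norm_ge].
  rewrite mulrC ler_pdivrMr // mulrC; apply: c0_norm_le => //.
  by rewrite mulr_ge0 // ltW.
exists (lp_norm p); split; first by right; exists p.
exists C => // y ny E e sy; apply: equivalent_of_nat_coef => n a.
have [lo up] := lp n a.
rewrite -(big_mkord xpredT (fun i => a i *: e i)) (agree y E e ny sy).
rewrite lp_normE ?(lt_le_trans ltr01) //; split=> //.
by rewrite mulrC ler_pdivrMr // mulrC.
Qed.
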